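(* Let $G$ be a finite group and $p$ a fixed prime divisor of $|G|$. Then every non-abelian subgroup of $G$ is a TI-subgroup of $G$ or subnormal in $G$ or has $p'$-order if and only if one of the following statements holds: (1) every non-abelian subgroup of $G$ of order divisible by $p$ is subnormal in $G$; (2) $p>2$ and $G=(Z_q)^r\rtimes(P\times H)$ is a Frobenius group with kernel $(Z_q)^r$ and complement $P\times H$, where $q$ is a prime with $q\neq p$ and $r>1$, $P$ is a Sylow $p$-subgroup of $G$ and $P$ is cyclic, $H$ is a direct product of the quaternion group $Q_8$ and a cyclic group of odd order, and every non-identity subgroup of $P$ acts irreducibly (by conjugation) on $(Z_q)^r$; (3) $p>2$ and $G=(Z_q)^r\rtimes(Z_p\rtimes H)$ is a Frobenius group with kernel $(Z_q)^r$ and complement $Z_p\rtimes H$, where $q$ is a prime with $q\neq p$ and $r>1$, $Z_p$ is a Sylow $p$-subgroup of $G$, $H$ is either a cyclic group or a direct product of the quaternion group $Q_8$ and a cyclic group of odd order such that $[Z_p,H]\neq 1$, and $Z_p$ acts irreducibly (by conjugation) on $(Z_q)^r$.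
   Context: All groups are finite. A subgroup $H$ of a group $G$ is a TI-subgroup of $G$ if for every $g\in G$, $H^g\cap H=1$ or $H^g\cap H=H$. A subgroup has $p'$-order if its order is not divisible by $p$. $Z_n$ denotes the cyclic group of order $n$, $(Z_q)^r$ the elementary abelian group of order $q^r$, and $Q_8$ the quaternion group of order $8$. *)

(* Defs.v *)
From mathcomp Require Import all_boot all_order all_fingroup all_solvable.
Set Implicit Arguments. Unset Strict Implicit. Unset Printing Implicit Defensive.
Local Open Scope group_scope.

Definition TI_subgroup (gT : finGroupType) (H G : {set gT}) : Prop :=
  forall g, g \in G -> (H :^ g :&: H = 1) \/ (H :^ g :&: H = H).

Definition Q8_times_odd_cyclic (gT : finGroupType) (H : {set gT}) : Prop :=
  exists (Q Z : {group gT}), [/\ Q \x Z = H, Q \isog 'Q_8, cyclic Z & odd #|Z|].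

(* Main.v *)
Require Import Defs.
From mathcomp Require Import all_boot all_fingroup all_solvable.
From mathcomp Require Import all_algebra all_character.
Set Implicit Arguments. Unset Strict Implicit. Unset Printing Implicit Defensive.
Local Open Scope group_scope.

(* If (1) fails, a maximal nonabelian non-subnormal subgroup L of order divisible
   by p is TI and self-normalising, so by Frobenius' theorem G is a Frobenius
   group with complement L and some kernel K. In a Frobenius group a subnormal
   subgroup not contained in the kernel contains it; with the maximality of L
   this makes K elementary abelian. Testing the hypothesis on K1 M, with M a
   subgroup of L of order divisible by p and K1 an M-invariant subgroup of K,
   shows that M acts irreducibly on K and is subnormal in L. Hence the Sylow
   p-subgroup P of L is normal, and for Y of order p in Z(P) Schur's lemma makes
   C_L(Y) abelian, hence cyclic. Testing the subgroups Y M with M in a complement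
   H of P in L gives P = Y and shows that every subgroup of H is normal; since
   H acts semiregularly on K it is cyclic or Q8 times an odd cyclic group: this
   is (3). The same Schur argument shows that (2) never occurs. *)

(** * Groups all of whose subgroups are normal *)

Section Dedekind.

Variable gT : finGroupType.
Implicit Types G H M Q S Z : {group gT}.

Definition dedekind (G : {set gT}) :=
  [forall M : {group gT}, (M \subset G) ==> (M <| G)].

Lemma dedekindP (G : {set gT}) :
  reflect (forall M : {group gT}, M \subset G -> M <| G) (dedekind G).
Proof. exact: 'forall_implyP. Qed.

Lemma dedekindS G H : H \subset G -> dedekind G -> dedekind H.
Proof.
move=> sHG /dedekindP dG; apply/dedekindP=> M sMH.
exact: normalS sMH sHG (dG M (subset_trans sMH sHG)).
Qed.

(** Each Sylow subgroup is normal and nilpotent, so it lies in ['F(G)]; together they generate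
    [G]. *)
Lemma dedekind_nilpotent G : dedekind G -> nilpotent G.
Proof.
move=> /dedekindP dG; suffices <-: 'F(G) = G by apply: Fitting_nil.
apply/eqP; rewrite eqEsubset Fitting_sub -{1}(Sylow_gen G) gen_subG.
apply/bigcupsP=> P /SylowP[p _ /and3P[sPG pP _]].
by rewrite Fitting_max ?dG ?(pgroup_nil pP).
Qed.

Lemma abelian_dedekind G : abelian G -> dedekind G.
Proof. by move=> cGG; apply/dedekindP=> M sMG; rewrite -sub_abelian_normal. Qed.

(** The subgroup [<[y]>] has order 4 and is normal with quotient an image of [<[x]>], so it contains
    the derived subgroup, properly because the latter lies in [<[x]>] and [y] does not. Hence
    [2 ^ (n - 2) < 4]. *)
Lemma quaternion_dedekind_card n G :
  2 < n -> G \isog 'Q_(2 ^ n) -> dedekind G -> n = 3.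
Proof.
move=> n_gt2 isoG /dedekindP dG.
have [[x y] genG [oy _ _]] := generators_quaternion n_gt2 isoG.
have [[_ _ _] [derG _ oG' _] _ _ _] := quaternion_structure n_gt2 genG isoG.
have [_ _ _ /setDP[Gy notXy]] := genG.
have sYG: <[y]> \subset G by rewrite cycle_subG.
have [_ _ _ defG _] := extremal_generators_facts (isT : prime 2) genG.
have sG'Y: G^`(1) \subset <[y]>.
  rewrite der1_min ?normal_norm ?dG //.
  have ->: G / <[y]> = <[x]> / <[y]>.
    rewrite -defG quotientMidr //.
  by rewrite quotient_abelian ?cycle_abelian.
have: #|G^`(1)| < 4.
  rewrite -oy ltn_neqAle subset_leq_card // andbT.
  apply: contra notXy => /eqP eqG'Y.
  have /eqP defY: G^`(1) == <[y]> by rewrite eqEcard sG'Y eqG'Y /=.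
  have: y \in G^`(1) by rewrite defY cycle_id.
  by rewrite derG; apply/subsetP; rewrite cycleX.
rewrite oG' (ltn_exp2l _ 2) //.
by case: n n_gt2 {isoG genG derG oG'} => [|[|[|[|n]]]].
Qed.

(** A subgroup of odd order lies in the cyclic normal Hall subgroup [Z]; one of even order contains
    the unique involution of [Q], which generates the derived subgroup of [H]. *)
Lemma Q8_times_odd_cyclic_dedekind H : Q8_times_odd_cyclic H -> dedekind H.
Proof.
case=> Q [Z [defH isoQ cycZ oddZ]]; apply/dedekindP=> M sMH.
have [_ defQZ cQZ tiQZ] := dprodP defH.
have n3 : 2 < 3 by [].
have [[x y] genQ _] := generators_quaternion n3 isoQ.
have [_ [derQ _ oQ' _] [_ _ uniq2 _ _] _ _] := quaternion_structure n3 genQ isoQ.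
have oQ: #|Q| = 8 by rewrite (card_isog isoQ) (@card_quaternion 3).
have coQZ: coprime #|Q| #|Z| by rewrite oQ (@coprime_pexpl 3 2) // coprime2n.
have sQH: Q \subset H by rewrite -defQZ mulG_subl.
have sZH: Z \subset H by rewrite -defQZ mulG_subr.
have derH: H^`(1) = Q^`(1).
  have [_ <- _ _] := dprodP (der_dprod 1 defH).
  by rewrite (derG1P (cyclic_abelian cycZ)) mulg1.
have [oddM | evM] := boolP (odd #|M|).
  have nsZH: Z <| H by have [] := dprod_normal2 defH.
  have sMZ: M \subset Z.
    have hallZ: 2^'.-Hall(H) Z.
      rewrite /pHall sZH /pgroup -odd_2'nat oddZ -divgS // -(dprod_card defH).
      by rewrite mulnK // oQ.
    by rewrite (sub_normal_Hall hallZ) // /pgroup -odd_2'nat.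
  by apply: char_normal_trans nsZH; rewrite sub_cyclic_char.
have [t Mt ot] := Cauchy (isT : prime 2) (etrans (dvdn2 _) evM).
have hallQ: 2.-Hall(H) Q.
  rewrite /pHall sQH /pgroup oQ -divgS // -(dprod_card defH) mulKn //.
  by rewrite -odd_2'nat oddZ.
have Qt: t \in Q.
  rewrite (mem_normal_Hall hallQ) ?(subsetP sMH) /p_elt ?ot //.
  by have [] := dprod_normal2 defH.
apply: sub_der1_normal sMH; rewrite derH derQ cycle_subG.
by have := uniq2 t Qt ot; rewrite /= expn1 => <-.
Qed.

End Dedekind.

(** * Frobenius kernels and semiregular actions on elementary abelian groups *)

Section Semiregular.

Variables (gT : finGroupType) (q : nat).
Implicit Types (G H K L S U Y : {group gT}).

Lemma Frobenius_normal_ker G K U :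
    [Frobenius G with kernel K] -> U <| G -> ~~ (U \subset K) -> K \subset U.
Proof.
case/Frobenius_kerP=> _ _ nsKG regK nsUG /subsetPn[u Uu notKu].
have Gu := subsetP (normal_sub nsUG) u Uu.
(* No nontrivial element of K commutes with u, so k |-> [~ k, u] permutes K. *)
have injR: {in K &, injective (commg^~ u)}.
  move=> k1 k2 Kk1 Kk2 /= eqR; apply/eqP; rewrite eq_mulgV1.
  apply: contraR notKu => nt12; apply: (subsetP (regK (k1 * k2^-1) _)).
    by rewrite !inE nt12 groupM ?groupV.
  rewrite inE Gu cent1C; apply/cent1P/commgP/conjg_fixP; rewrite conjMg conjVg.
  move: eqR; rewrite !commgEl => eqR.
  have ->: k1 ^ u = k1 * (k2^-1 * k2 ^ u) by rewrite -eqR mulKVg.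
  by move: (k2 ^ u) => w; rewrite mulgA mulgK.
have sRK: [set [~ k, u] | k in K] \subset K.
  apply/subsetP=> _ /imsetP[k Kk ->]; rewrite commgEl groupM ?groupV //.
  by rewrite memJ_norm // (subsetP (normal_norm nsKG)).
have /eqP <-: [set [~ k, u] | k in K] == K by rewrite eqEcard sRK card_in_imset /=.
apply/subsetP=> _ /imsetP[k Kk ->]; rewrite commgEr groupM //.
by rewrite memJ_norm ?groupV //
           ?(subsetP (normal_norm nsUG)) // (subsetP (normal_sub nsKG)).
Qed.

(** Induction down a subnormal series: its first proper term [M] contains [K] by the normal case, so
    [M] is again Frobenius with kernel [K]. *)
Lemma Frobenius_subnormal_ker G K U :
    [Frobenius G with kernel K] -> U <|<| G -> ~~ (U \subset K) -> K \subset U.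
Proof.
have [n] := ubnP #|G|; elim: n G => // n IHn G /ltnSE-leGn frobG snUG notUK.
have [defU | [M [snUM nsMG ltMG]]] := subnormalEr snUG.
  by apply: (Frobenius_normal_ker frobG); rewrite // defU normal_refl.
have notMK: ~~ (M \subset K).
  by apply: contra notUK; apply: subset_trans (subnormal_sub snUM).
have sKM := Frobenius_normal_ker frobG nsMG notMK.
apply: (IHn M) => //; first exact: leq_trans (proper_card ltMG) leGn.
by apply: Frobenius_kerS frobG; rewrite ?normal_sub // properE sKM.
Qed.

(** On a minimal [L]-invariant subgroup of [K] the action is irreducible, and faithful by
    semiregularity; a group with such a representation has cyclic centre. *)
Lemma semiregular_abelian_cyclic K L :
    q.-abelem K -> K :!=: 1 -> L \subset 'N(K) -> semiregular K L ->
  abelian L -> cyclic L.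
Proof.
move=> abelK ntK nKL regL cLL.
have [K1 minK1 sK1K] := minnormal_exists ntK nKL.
have [/andP[ntK1 nK1L] _] := mingroupP minK1.
have abelK1 := abelemS sK1K abelK.
rewrite -(center_idP cLL).
apply: (mx_faithful_irr_center_cyclic (rG := abelem_repr abelK1 ntK1 nK1L)).
  apply: abelem_mx_faithful; apply: (cent_semiregular (semiregular_sym regL)) => //.
exact/abelem_mx_irrP.
Qed.

(* An element of L centralising Y maps a fixed vector u of K to u * A with A in
   the commutative algebra spanned by Y, so any two of them agree on u in either
   order; semiregularity then makes them commute. *)
Lemma irr_abelian_cent_abelian K L Y :
    q.-abelem K -> L \subset 'N(K) -> semiregular K L ->
  Y \subset L -> abelian Y -> minnormal K Y -> abelian 'C_L(Y).
Proof.
move=> abelK nKL regL sYL cYY minK.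
have [/andP[ntK nKY] _] := mingroupP minK.
pose rL := abelem_repr abelK ntK nKL.
pose rY := abelem_repr abelK ntK nKY.
(* Irreducibility concerns [rY], while centralising elements act through [rL]; on [Y] the two
   representations have to be identified. *)
have eqr y : y \in Y -> rY y = rL y.
  move=> Yy; have Ly := subsetP sYL y Yy; apply/row_matrixP=> i.
  by apply: (@rVabelem_inj _ _ _ abelK ntK); rewrite !rowE !rVabelemJ.
have /(abelem_mx_irrP abelK ntK nKY)/mx_irrP[_ irrY] := minK.
have [k Kk ntk] := trivgPn _ ntK.
pose u := abelem_rV abelK ntK k.
have nzu: u != 0%R by rewrite (morph_injm_eq1 (abelem_rV_injm abelK ntK)).
have fullu: row_full (cyclic_mx rY u).
  by apply: irrY; rewrite ?cyclic_mx_module ?cyclic_mx_eq0.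
have cYr c y : c \in 'C_L(Y) -> y \in Y -> comm_mx (rL c) (rY y).
  case/setIP=> Lc cYc Yy; have Ly := subsetP sYL y Yy.
  by rewrite /comm_mx eqr // -!repr_mxM // (centP cYc).
have comE B : (forall y, y \in Y -> comm_mx B (rY y)) ->
    forall A, (A \in enveloping_algebra_mx rY)%MS -> comm_mx B A.
  move=> cB A /envelop_mxP[a ->]; rewrite /comm_mx mulmx_sumr mulmx_suml.
  by apply: eq_bigr => y Yy; rewrite -scalemxAr -scalemxAl cB.
have comEE A B : (A \in enveloping_algebra_mx rY)%MS ->
    (B \in enveloping_algebra_mx rY)%MS -> comm_mx A B.
  move=> EA EB; apply: (comE A) EB => y Yy; apply/comm_mx_sym.
  apply: (comE (rY y)) EA => z Yz.
  by rewrite /comm_mx -!repr_mxM // (centsP cYY).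
apply/centsP=> c Cc d Cd; have [Lc _] := setIP Cc; have [Ld _] := setIP Cd.
have /cyclic_mxP[A EA defc] := submx_full (u *m rL c) fullu.
have /cyclic_mxP[B EB defd] := submx_full (u *m rL d) fullu.
have eq_k: k ^ (c * d) = k ^ (d * c).
  apply: (injmP (abelem_rV_injm abelK ntK)); rewrite ?memJ_norm ?(subsetP nKL) ?groupM //.
  rewrite /= !(abelem_rV_J abelK ntK nKL) ?groupM // !repr_mxM // !mulmxA.
  rewrite -/u defc defd.
  rewrite -!mulmxA -(comE _ (fun y => cYr d y Cd) _ EA)
          -(comE _ (fun y => cYr c y Cc) _ EB).
  by rewrite !mulmxA defc defd -!mulmxA (comEE _ _ EA EB).
apply/commgP; apply: contraR ntk => nt_cd.
have Lcd: [~ c, d] \in L^# by rewrite !inE nt_cd groupR.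
have: k ^ (d * c) \in 'C_K[[~ c, d]].
  apply/setIP; split; first by rewrite memJ_norm ?(subsetP nKL) ?groupM.
  by apply/cent1P/commgP/conjg_fixP; rewrite -conjgM -commgC eq_k.
rewrite regL // => /set1P/eqP.
by rewrite conjg_eq1.
Qed.

(** An element of order [s] and a central [z] of order [s] generate an abelian, hence cyclic, group,
    so [<[z]>] is the only subgroup of order [s]. This forces [S] to be cyclic or generalised
    quaternion. *)
Lemma semiregular_pgroup_cyclic_quaternion K S (s : nat) :
    q.-abelem K -> K :!=: 1 -> S \subset 'N(K) -> semiregular K S ->
  s.-group S -> cyclic S || (s == 2) && (extremal_class S == Quaternion).
Proof.
move=> abelK ntK nKS regS sS.
have [-> | ntS] := eqVneq S 1%G; first by rewrite cyclic1.
have [s_pr s_dvd _] := pgroup_pdiv sS ntS.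
have sZ: s %| #|'Z(S)|.
  have [] // := pgroup_pdiv (pgroupS (center_sub S) sS).
  by rewrite (center_nil_eq1 (pgroup_nil sS)).
have [z Zz oz] := Cauchy s_pr sZ.
have [Sz cSz] := setIP Zz.
apply/(prime_Ohm1P sS ntS); rewrite -oz; congr #|pred_of_set _|; apply/eqP.
rewrite eqEsubset (OhmE _ sS) gen_subG; apply/andP; split; last first.
  by rewrite cycle_subG mem_gen // !inE Sz -oz expg_order /=.
apply/subsetP=> x; rewrite !inE expn1 => /andP[Sx /eqP xs].
have [-> // | ntx] := eqVneq x 1.
have ox: #[x] = s by apply: nt_prime_order.
pose A := <[x]> <*> <[z]>.
have cAA: abelian A.
  rewrite abelianY !cycle_abelian /= cent_cycle cycle_subG.
  by apply/cent1P; apply: (centP cSz).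
have sAS: A \subset S by rewrite join_subG !cycle_subG Sx Sz.
have cycA: cyclic A.
  apply: semiregular_abelian_cyclic abelK ntK _ _ cAA => /=.
    exact: subset_trans nKS.
  exact: semiregularS regS.
have: <[x]> == <[z]>.
  by rewrite (eq_subG_cyclic cycA) ?joing_subl ?joing_subr // -!orderE ox oz.
by move/eqP=> eqxz; rewrite -cycle_subG eqxz.
Qed.

End Semiregular.

(** * Subnormal Hall subgroups, TI-subgroups, and semiregular Dedekind groups *)

Section General.

Variable gT : finGroupType.
Implicit Types (G H K L M N P U Y : {group gT}).

Lemma acts_irreduciblyJ Y K : acts_irreducibly Y K 'J = minnormal K Y.
Proof.
by apply/mingroupP/mingroupP=> -[/andP[ntK nKY] minK]; split;
  rewrite ?astabsJ in nKY *; rewrite ?ntK // => K1 /andP[ntK1 nK1Y];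
  apply: minK; rewrite ?astabsJ in nK1Y *; rewrite ntK1.
Qed.

(** By induction [H] is a normal Hall subgroup of a normal [M], hence is its [pi]-core, which is
    characteristic in [M]. *)
Lemma Hall_subnormal_normal (pi : nat_pred) G H :
  pi.-Hall(G) H -> H <|<| G -> H <| G.
Proof.
have [n] := ubnP #|G|; elim: n G => // n IHn G /ltnSE-leGn hallH snHG.
have [-> | [M [snHM nsMG ltMG]]] := subnormalEr snHG; first exact: normal_refl.
have hallHM := pHall_subl (subnormal_sub snHM) (normal_sub nsMG) hallH.
have nsHM := IHn M (leq_trans (proper_card ltMG) leGn) hallHM snHM.
rewrite -(normal_Hall_pcore hallHM nsHM).
exact: char_normal_trans (pcore_char _ _) nsMG.
Qed.

(** Every conjugate of [U] under [M] still contains [N], so it meets [U] nontrivially and must equal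
    [U]. *)
Lemma TI_subgroup_norm G U N M :
    TI_subgroup U G -> M \subset G -> N :!=: 1 -> N \subset U ->
  M \subset 'N(N) -> M \subset 'N(U).
Proof.
move=> tiU sMG ntN sNU /subsetP nNM; apply/subsetP=> g Mg.
have sNUg: N \subset U :^ g :&: U.
  by rewrite subsetI sNU -(normP (nNM g Mg)) conjSg sNU.
have [tiUg | /setIidPr sUUg] := tiU g (subsetP sMG g Mg).
  by rewrite tiUg subG1 (negPf ntN) in sNUg.
by apply/normP/esym/eqP; rewrite eqEcard sUUg cardJg /=.
Qed.

Lemma Frobenius_nonabelian G K H : [Frobenius G = K ><| H] -> ~~ abelian G.
Proof.
move=> frobG; have [/sdprodW defG ntK _ _ _] := Frobenius_context frobG.
apply: contra ntK => cGG; rewrite -subG1 -(Frobenius_trivg_cent frobG) subsetI subxx.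
by apply: sub_abelian_cent2 cGG _ _; rewrite -defG (mulG_subl, mulG_subr).
Qed.

Lemma semiregular_dedekind_cyclic_Q8 q K H :
    q.-abelem K -> K :!=: 1 -> H \subset 'N(K) -> semiregular K H ->
  dedekind H -> cyclic H \/ Q8_times_odd_cyclic H.
Proof.
move=> abelK ntK nKH regH dH; have nilH := dedekind_nilpotent dH.
(* Sylow subgroups for odd primes are cyclic by semiregularity, so only the prime 2 can keep the
   nilpotent group [M] from being cyclic. *)
have oddcyc (M : {group gT}) : M \subset H ->
    (forall S : {group gT}, 2.-Sylow(M) S -> cyclic S) -> cyclic M.
  move=> sMH cyc2; apply: nil_Zgroup_cyclic; last exact: nilpotentS nilH.
  apply/forall_inP=> S /SylowP[s _ sylS]; have sSM := pHall_sub sylS.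
  have sSH := subset_trans sSM sMH.
  have := semiregular_pgroup_cyclic_quaternion abelK ntK
    (subset_trans sSH nKH) (semiregularS (subxx K) sSH regH) (pHall_pgroup sylS).
  by case/orP=> // /andP[/eqP s2 _]; apply: cyc2; rewrite -s2.
have syl2 := nilpotent_pcore_Hall 2 nilH.
have sSH: 'O_2(H) \subset H := pcore_sub _ _.
have := semiregular_pgroup_cyclic_quaternion abelK ntK
    (subset_trans sSH nKH) (semiregularS (subxx K) sSH regH) (pcore_pgroup 2 H).
case/orP=> [cycS | /andP[_ /eqP/quaternion_classP[n n_gt2 isoS]]].
  left; apply: oddcyc => // S sylS.
  by rewrite (nilpotent_Hall_pcore nilH sylS).
right; have n3 := quaternion_dedekind_card n_gt2 isoS (dedekindS sSH dH).
have odd2': odd #|'O_2^'(H)| by rewrite odd_2'nat; apply: pcore_pgroup.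
exists 'O_2(H)%G, 'O_2^'(H)%G; split=> //=.
- exact: nilpotent_pcoreC.
- by rewrite n3 in isoS.
apply: oddcyc => [|S sylS]; first exact: pcore_sub.
suffices ->: S :=: 1 by rewrite cyclic1.
apply: card1_trivg; rewrite (card_Hall sylS) part_p'nat // -odd_2'nat //.
Qed.

End General.

(** * Maximal violators of (1) as Frobenius complements *)

Section Maximal.

Variables (gT : finGroupType) (G : {group gT}) (p : nat).
Implicit Types (H K L M N P U Y : {group gT}).

Hypothesis TI_or_subnormal : forall U : {group gT},
  U \subset G -> ~~ abelian U -> p %| #|U| -> TI_subgroup U G \/ U <|<| G.

(** The violators of (1), as a boolean predicate so that [maxgroup] applies. *)
Definition exceptional (U : {group gT}) :=
  [&& U \subset G, ~~ abelian U, p %| #|U| & ~~ (U <|<| G)].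

Lemma max_exceptional_Frobenius L :
  [max L | exceptional L] -> exists K : {group gT}, [Frobenius G = K ><| L].
Proof.
case/maxgroupP=> /and4P[sLG ncLL p_L notsnL] maxL.
have [tiL | snL] := TI_or_subnormal sLG ncLL p_L; last by rewrite snL in notsnL.
(* If the normaliser were not exceptional it would be subnormal, and so would [L]; hence maximality
   of [L] applies to it. *)
have defN: 'N_G(L) = L.
  have sLN: L \subset 'N_G(L) by rewrite subsetI sLG normG.
  have [/maxL-> // | ] := boolP (exceptional 'N_G(L)).
  rewrite /exceptional subsetIl (contra (abelianS sLN)) //= (dvdn_trans p_L) ?cardSg //=.
  rewrite negbK => snN; case/negP: notsnL; apply: subnormal_trans snN.
  by apply: normal_subnormal; rewrite normalSG.
have ntL: L :!=: 1 by apply: contraNneq ncLL => ->; apply: abelian1.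
suffices /Frobenius_kernel_exists[K]: [Frobenius G with complement L] by exists K.
apply/andP; split.
  by apply: contraNneq notsnL => ->; apply: subnormal_refl.
apply/normedTI_P; split; first by rewrite setD_eq0 subG1.
  by rewrite normD1 defN.
move=> g Gg ndisj; rewrite -defN inE Gg /=.
have [tiLg | /setIidPr sLLg] := tiL g Gg.
  case/negP: ndisj; rewrite -setI_eq0 conjD1g -setDIl setIC tiLg.
  by rewrite setDv.
by apply/normP/esym/eqP; rewrite eqEcard sLLg cardJg /=.
Qed.

(** For a nontrivial [G]-invariant [K1] in [K], the product [K1 L] is larger than [L], hence
    subnormal, hence contains [K]; the modular law then gives [K1 = K]. *)
Lemma max_exceptional_minnormal K L :
  [max L | exceptional L] -> [Frobenius G = K ><| L] -> minnormal K G.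
Proof.
move=> maxexL frobG; have [/and4P[sLG ncLL p_L _] maxL] := maxgroupP maxexL.
have [defG ntK ntL _ _] := Frobenius_context frobG.
have [nsKG _ mulKL nKL tiKL] := sdprod_context defG.
apply/mingroupP; rewrite ntK normal_norm //; split=> // K1 /andP[ntK1 nK1G] sK1K.
have sLK1L := joing_subr K1 L.
have sK1LG: K1 <*> L \subset G.
  by rewrite join_subG sLG (subset_trans sK1K) ?normal_sub.
have nK1L := subset_trans sLG nK1G.
have : ~~ exceptional (K1 <*> L).
  apply/negP=> /maxL/(_ sLK1L) eqL; case/negP: ntK1; rewrite -subG1 -tiKL subsetI sK1K.
  by rewrite -eqL joing_subl.
rewrite /exceptional sK1LG (contra (abelianS sLK1L)) //= (dvdn_trans p_L) ?cardSg //=.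
rewrite negbK => snK1L.
have sKK1L: K \subset K1 <*> L.
  apply: Frobenius_subnormal_ker (FrobeniusWker frobG) snK1L _.
  apply: contra ntL => sK1LK; rewrite -subG1 -tiKL subsetI subxx andbT.
  exact: subset_trans sK1LK.
apply/eqP; rewrite eqEsubset sK1K -(setIidPr sKK1L) norm_joinEr //.
by rewrite -group_modl // setIC tiKL mulg1 subxx.
Qed.

(* If the normaliser of a Sylow subgroup Q of K were proper, it would be
   exceptional and lie in a second Frobenius complement; as the two kernels are
   comparable, Q would meet that complement and its kernel nontrivially. *)
Lemma max_exceptional_kernel_abelem K L :
  [max L | exceptional L] -> [Frobenius G = K ><| L] -> exists2 q, prime q & q.-abelem K.
Proof.
move=> maxexL frobG; have [/and4P[sLG ncLL p_L _] maxL] := maxgroupP maxexL.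
have [defG ntK ntL _ _] := Frobenius_context frobG.
have [nsKG _ mulKL nKL tiKL] := sdprod_context defG.
have minK := max_exceptional_minnormal maxexL frobG.
pose q := pdiv #|K|; have q_pr: prime q by rewrite pdiv_prime ?cardG_gt1.
have [Q sylQ] := Sylow_exists q K; have sQK := pHall_sub sylQ.
have ntQ: Q :!=: 1.
  rewrite -cardG_gt1 (card_Hall sylQ) p_part_gt1 mem_primes q_pr cardG_gt0.
  exact: pdiv_dvd.
have defKN := Frattini_arg nsKG sylQ.
suffices nQG: G \subset 'N(Q).
  have defK: K :=: Q.
    by have [_ minK'] := mingroupP minK; rewrite (minK' Q) ?ntQ.
  have qK: q.-group K by rewrite defK (pHall_pgroup sylQ).
  exists q => //.
  by have [] := minnormal_solvable minK (subxx K) (pgroup_sol qK).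
apply: contraT => notnQG.
have sQN: Q \subset 'N_G(Q) by rewrite subsetI normG (subset_trans sQK) ?normal_sub.
(* By the Frattini argument the normaliser of [Q] covers [G / K], a copy of [L], so it is nonabelian
   of order divisible by [p]. Were it subnormal it would contain [K] and be all of [G]. *)
have isoGK: 'N_G(Q) / K = G / K by rewrite -{2}defKN quotientMidl.
have isoL: L \isog G / K by apply: sdprod_isog.
have exN: exceptional 'N_G(Q).
  rewrite /exceptional subsetIl /=; apply/and3P; split.
  - apply: contra ncLL => cNN; rewrite (isog_abelian isoL) /= -isoGK.
    exact: quotient_abelian.
  - by rewrite (dvdn_trans p_L) // (card_isog isoL) /= -isoGK dvdn_quotient.
  apply/negP=> snN; case/negP: notnQG.
  have sKN: K \subset 'N_G(Q).
    apply: Frobenius_subnormal_ker (FrobeniusWker frobG) snN _.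
    apply: contra ntL => sNK.
    by rewrite (isog_eq1 isoL) /= -isoGK (quotientS1 sNK).
  by rewrite -defKN mulSGid ?subsetIr.
have [L2 maxL2 sNL2] := maxgroup_exists exN.
have [K2 frobG2] := max_exceptional_Frobenius maxL2.
have [defG2 ntK2 _ _ _] := Frobenius_context frobG2.
have [nsK2G _ _ _ tiKL2] := sdprod_context defG2.
case/negP: ntQ; rewrite -subG1 -tiKL2 subsetI (subset_trans sQN sNL2) andbT.
have [sK2K | notsK2K] := boolP (K2 \subset K).
  have [_ minK'] := mingroupP minK.
  by rewrite (minK' K2) ?ntK2 ?normal_norm.
apply: subset_trans sQK _.
exact: Frobenius_normal_ker (FrobeniusWker frobG) nsK2G notsK2K.
Qed.

End Maximal.

(** * Structure of a nonabelian Frobenius complement of order divisible by [p] *)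

Section Complement.

Variables (gT : finGroupType) (G K L : {group gT}) (p q : nat).
Implicit Types (H M N P U Y : {group gT}).

Hypothesis p_pr : prime p.
Hypothesis TI_or_subnormal : forall U : {group gT},
  U \subset G -> ~~ abelian U -> p %| #|U| -> TI_subgroup U G \/ U <|<| G.
Hypotheses (frobG : [Frobenius G = K ><| L]) (abelK : q.-abelem K).
Hypotheses (ncLL : ~~ abelian L) (p_L : p %| #|L|).

Let defG : K ><| L = G. Proof. by have [] := Frobenius_context frobG. Qed.
Let ntK : K :!=: 1. Proof. by have [] := Frobenius_context frobG. Qed.
Let nsKG : K <| G. Proof. by have [] := sdprod_context defG. Qed.
Let sLG : L \subset G. Proof. by have [] := sdprod_context defG. Qed.
Let sKG : K \subset G. Proof. exact: normal_sub. Qed.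
Let nKL : L \subset 'N(K). Proof. by have [] := sdprod_context defG. Qed.
Let tiKL : K :&: L = 1. Proof. by have [] := sdprod_context defG. Qed.
Let regL : semiregular K L. Proof. exact: Frobenius_reg_ker frobG. Qed.

Let nt_p M : p %| #|M| -> M :!=: 1.
Proof.
by apply: contraTneq => ->; rewrite cards1 dvdn1 neq_ltn prime_gt1 ?orbT.
Qed.

Lemma complement_minnormal M : M \subset L -> p %| #|M| -> minnormal K M.
Proof.
move=> sML p_M; have ntM := nt_p p_M.
apply/mingroupP; rewrite ntK (subset_trans sML) //; split=> // K1 /andP[ntK1 nK1M] sK1K.
have frobKM := Frobenius_subr ntM sML frobG.
have frobK1M := Frobenius_subl ntK1 sK1K nK1M frobKM.
have sUG: K1 <*> M \subset G.
  by rewrite join_subG (subset_trans sK1K) ?(subset_trans sML).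
have sMU: M \subset K1 <*> M := joing_subr _ _.
have notsUK: ~~ (K1 <*> M \subset K).
  apply: contra ntM => sUK; rewrite -subG1 -tiKL subsetI sML andbT.
  exact: subset_trans sUK.
have sKU: K \subset K1 <*> M.
  have p_U: p %| #|K1 <*> M| by rewrite (dvdn_trans p_M) ?cardSg.
  have [tiU | snU] := TI_or_subnormal sUG (Frobenius_nonabelian frobK1M) p_U.
    apply: Frobenius_normal_ker (FrobeniusWker frobKM) _ notsUK.
    rewrite /normal join_subG (subset_trans sK1K) ?joing_subl ?joing_subr //=.
    rewrite join_subG (subset_trans sMU) ?normG // andbT.
    apply: TI_subgroup_norm tiU sKG ntK1 (joing_subl _ _) _.
    exact: cents_norm (subset_trans (abelem_abelian abelK) (centS sK1K)).
  exact: Frobenius_subnormal_ker (FrobeniusWker frobG) snU notsUK.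
apply/eqP; rewrite eqEsubset sK1K -(setIidPr sKU) norm_joinEr //.
rewrite -group_modl // setIC.
have ->: K :&: M = 1 by apply/trivgP; rewrite -tiKL setIS.
by rewrite mulg1 subxx.
Qed.

(** The hypothesis is tested on [K M], which is normal if it is TI because [G] normalises [K];
    intersecting with [L] recovers [M]. *)
Lemma complement_subnormal M : M \subset L -> p %| #|M| -> M <|<| L.
Proof.
move=> sML p_M; have ntM := nt_p p_M; have nKM := subset_trans sML nKL.
have frobKM := Frobenius_subr ntM sML frobG.
have sUG: K <*> M \subset G by rewrite join_subG sKG (subset_trans sML).
have snU: K <*> M <|<| G.
  have p_U: p %| #|K <*> M| by rewrite (dvdn_trans p_M) ?cardSg ?joing_subr.
  have [tiU | //] := TI_or_subnormal sUG (Frobenius_nonabelian frobKM) p_U.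
  rewrite normal_subnormal // /normal sUG.
  apply: TI_subgroup_norm tiU _ ntK (joing_subl _ _) _ => //.
  exact: normal_norm.
have := setI_subnormal sLG snU.
rewrite /= norm_joinEr // setIC -group_modr // [L :&: K]setIC tiKL mul1g //.
Qed.

(** The hypothesis is tested on [M] itself: if subnormal it would contain [K], and if TI it is
    normalised by [L] because [N] is. *)
Lemma complement_norm M N : M \subset L -> ~~ abelian M -> N \subset M ->
  p %| #|N| -> N <| L -> M <| L.
Proof.
move=> sML ncMM sNM p_N /andP[sNL nNL]; have sMG := subset_trans sML sLG.
rewrite /normal sML.
have p_M: p %| #|M| by rewrite (dvdn_trans p_N) ?cardSg.
have [tiM | snM] := TI_or_subnormal sMG ncMM p_M.
  exact: TI_subgroup_norm tiM sLG (nt_p p_N) sNM nNL.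
case/negP: ntK; rewrite -subG1 -tiKL subsetI subxx.
apply: subset_trans (sML).
apply: Frobenius_subnormal_ker (FrobeniusWker frobG) snM _.
by apply: contra (nt_p p_M) => sMK; rewrite -subG1 -tiKL subsetI sMK.
Qed.

Lemma complement_structure :
  2 < p /\ exists X H : {group gT},
   [/\ X ><| H = L, p.-Sylow(L) X, #|X| = p, cyclic H \/ Q8_times_odd_cyclic H
     & [~: X, H] != 1].
Proof.
have [P sylP] := Sylow_exists p L; have [sPL pP _] := and3P sylP.
have ntP: P :!=: 1.
  by rewrite -cardG_gt1 (card_Hall sylP) p_part_gt1 mem_primes p_pr cardG_gt0.
have [_ p_P _] := pgroup_pdiv pP ntP.
have nsPL: P <| L := Hall_subnormal_normal sylP (complement_subnormal sPL p_P).
have p_ZP: p %| #|'Z(P)|.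
  have [] // := pgroup_pdiv (pgroupS (center_sub P) pP).
  by rewrite (center_nil_eq1 (pgroup_nil pP)).
have [z Zz oz] := Cauchy p_pr p_ZP; have [Pz cPz] := setIP Zz.
pose Y := <[z]>%G; have oY: #|Y| = p by [].
have sYP: Y \subset P by rewrite cycle_subG.
have sYL := subset_trans sYP sPL.
have p_Y: p %| #|Y| by rewrite oY.
pose D := 'C_L(Y)%G; have sDL: D \subset L := subsetIl _ _.
have minKY := complement_minnormal sYL p_Y.
have cDD: abelian D.
  exact: irr_abelian_cent_abelian abelK nKL regL sYL (cycle_abelian z) minKY.
have cycD: cyclic D.
  apply: semiregular_abelian_cyclic abelK ntK (subset_trans sDL nKL) _ cDD.
  exact: semiregularS regL.
have sPD: P \subset D by rewrite subsetI sPL /= cent_cycle sub_cent1 cPz.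
have cycP := cyclicS sPD cycD.
have nsYL: Y <| L.
  by apply: char_normal_trans nsPL; rewrite sub_cyclic_char.
have nsDL: D <| L.
  by rewrite /normal sDL normsI ?normG // norms_cent // normal_norm.
have notcYL: ~~ (L \subset 'C(Y)).
  by apply: contra ncLL => cYL; rewrite -(setIidPl cYL).
(* A normal subgroup of order 2 is central, but [Y] is not central in [L]. *)
have p_gt2: 2 < p.
  rewrite ltn_neqAle prime_gt1 // andbT; apply: contra notcYL => /eqP p2.
  rewrite centsC cycle_subG; apply/centP=> g Lg; apply/commgP/conjg_fixP.
  have: z ^ g \in Y by rewrite memJ_norm ?cycle_id // (subsetP (normal_norm nsYL)).
  rewrite /= cycle2g ?oz // !inE conjg_eq1 -order_eq1 oz -p2 /=.
  by move/eqP.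
split=> //.
have /splitsP[H /complP[tiPH defPH]]: [splits L, over P].
  by apply: SchurZassenhaus_split nsPL; apply: pHall_Hall sylP.
have sHL: H \subset L by rewrite -defPH mulG_subr.
have nPH: H \subset 'N(P) := subset_trans sHL (normal_norm nsPL).
have defL: P ><| H = L by rewrite sdprodE.
have nYH: H \subset 'N(Y) := subset_trans sHL (normal_norm nsYL).
have notcYH: ~~ (H \subset 'C(Y)).
  apply: contra notcYL => cYH; rewrite -defPH mul_subG //.
  exact: subset_trans sPD (subsetIr _ _).
have normYM M : M \subset H -> ~~ (M \subset 'C(Y)) -> Y <*> M <| L.
  move=> sMH notcYM; apply: complement_norm (joing_subl Y M) p_Y nsYL.
    by rewrite join_subG sYL (subset_trans sMH).
  apply: contra notcYM => cYM; apply: sub_abelian_cent2 cYM _ _.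
    exact: joing_subr.
  exact: joing_subl.
have coPH: coprime #|P| #|H|.
  by rewrite (coprime_sdprod_Hall_l defL) (pHall_Hall sylP).
have tiYH: Y :&: H = 1 by apply/trivgP; rewrite -tiPH setSI.
(* Since [Y H] is normal in [L], [[~: P, H]] lies in the intersection of [P] and [Y H], which is
   [Y]. So [H] centralises [P / Y], and by coprime action [P / Y] is the image of ['C_P(H)]. That is
   trivial, as otherwise it would contain [Y], the only subgroup of order [p] of the cyclic [P]. *)
have defPY: P :=: Y.
  have sRY: [~: P, H] \subset Y.
    have sRYH: [~: P, H] \subset Y <*> H.
      apply: subset_trans (commgS _ (joing_subr Y H)) _.
      rewrite commg_subr (subset_trans sPL) // normal_norm //.
      exact: normYM.
    have sRP: [~: P, H] \subset P by rewrite commg_subl.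
    have := subsetI [~: P, H] P (Y <*> H).
    by rewrite sRP sRYH norm_joinEr // setIC -group_modl // setIC tiPH mulg1.
  have ti: 'C_P(H) = 1.
    apply: contraNeq notcYH => ntC.
    have p_C: p %| #|'C_P(H)|.
      by have [] := pgroup_pdiv (pgroupS (subsetIl _ _) pP) ntC.
    have [w /setIP[Pw cHw] ow] := Cauchy p_pr p_C.
    have eqYw: <[z]> == <[w]>.
      by rewrite (eq_subG_cyclic cycP) ?cycle_subG // -!orderE oz ow.
    by rewrite centsC /= (eqP eqYw) cycle_subG.
  apply/eqP; rewrite eqEsubset sYP andbT.
  have nYP: P \subset 'N(Y) := subset_trans sPL (normal_norm nsYL).
  rewrite -quotient_sub1 // -(setIidPl (quotient_cents2r sRY)).
  rewrite -coprime_quotient_cent ?ti ?quotient1 //.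
  exact/abelian_sol/cyclic_abelian.
exists P, H; split=> //.
- by rewrite defPY.
- apply: (semiregular_dedekind_cyclic_Q8 abelK ntK (subset_trans sHL nKL)).
    exact: semiregularS regL.
  (* If [M] centralises [Y], it is characteristic in the cyclic normal subgroup [D]. Otherwise [Y M]
     is normal in [L] and meets [H] in [M]. *)
  apply/dedekindP=> M sMH; have [cYM | notcYM] := boolP (M \subset 'C(Y)).
    apply: (normalS sMH sHL).
    apply: char_normal_trans nsDL; rewrite sub_cyclic_char // subsetI cYM andbT.
    exact: subset_trans sHL.
  have: (Y <*> M) :&: H <| H.
    have [_ nYML] := andP (normYM M sMH notcYM).
    by rewrite /normal subsetIr normsI ?normG // (subset_trans sHL).
  rewrite norm_joinEr ?(subset_trans sMH) // setIC -group_modr // [H :&: Y]setIC.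
  by rewrite tiYH mul1g.
by rewrite defPY (sameP eqP commG1P) centsC.
Qed.

End Complement.

(** * Subgroups of the Frobenius groups in (3) *)

Section Converse.

Variable gT : finGroupType.
Implicit Types (A C G H K N P Q U V X Y Z : {group gT}).

Lemma Q8_times_odd_cyclic_nonabelian H : Q8_times_odd_cyclic H -> ~~ abelian H.
Proof.
case=> Q [Z [defH isoQ _ _]]; have n3 : 2 < 3 by [].
have [[x y] genQ _] := generators_quaternion n3 isoQ.
have [_ [_ _ oQ' _] _ _ _] := quaternion_structure n3 genQ isoQ.
have sQH: Q \subset H by rewrite -(dprodW defH) mulG_subl.
by apply/negP=> /(abelianS sQH)/derG1P Q'1; rewrite Q'1 cards1 in oQ'.
Qed.

(** By the modular law [U] is [N] times its intersection with [H]; both factors are normalised by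
    [N H], up to [N]. *)
Lemma dedekind_quotient_normal A N H U :
  N <| A -> N * H = A -> dedekind H -> N \subset U -> U \subset A -> U <| A.
Proof.
move=> /andP[_ nNA] defA /dedekindP dH sNU sUA; rewrite /normal sUA.
have sHA: H \subset A by rewrite -defA mulG_subr.
have defU: N * (H :&: U) = U.
  by rewrite group_modl // defA (setIidPr sUA).
rewrite -defA mul_subG ?(subset_trans sNU) ?normG // -defU normsM //.
  exact: subset_trans nNA.
exact/normal_norm/dH/subsetIl.
Qed.

Lemma TI_subgroupJ G (U : {set gT}) x :
  x \in G -> TI_subgroup (U :^ x) G -> TI_subgroup U G.
Proof.
move=> Gx tiUx g Gg; have := tiUx (g ^ x) (groupJ Gg Gx).
rewrite -conjsgM -conjgC conjsgM -conjIg.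
by case=> /(canRL (conjsgK x)) ->; rewrite ?conjs1g ?conjsgK; [left | right].
Qed.

Lemma Frobenius_compl_TI_subgroup G K C V :
  [Frobenius G = K ><| C] -> V <| C -> TI_subgroup V G.
Proof.
case/andP=> _ /andP[_ /normedTI_memJ_P[_ _ tiC]] /andP[sVC nVC] g Gg.
have [Cg | notCg] := boolP (g \in C).
  by right; rewrite (normsP nVC) ?setIid.
left; apply/trivgP/subsetP=> v; rewrite inE => /andP[/imsetP[u Vu def_v] Vv].
apply: contraR notCg; rewrite inE => ntv.
rewrite -(tiC u) // !inE -?def_v ?ntv ?(subsetP sVC) //= andbT.
by apply: contraNneq ntv => u1; rewrite def_v u1 conj1g.
Qed.

(** Some conjugate [V] of [U] contains [X], so by irreducibility [V] contains [K] or meets it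
    trivially. In the first case [U] contains the normal subgroup [K X], whose quotient is Dedekind.
    In the second [V] normalises [X], so it lies in [C], where it is normal. *)
Lemma Frobenius_prime_irr_TI_or_normal p G K C X H U :
    prime p -> [Frobenius G = K ><| C] -> X ><| H = C -> p.-Sylow(G) X ->
    #|X| = p -> dedekind H -> minnormal K X -> U \subset G -> p %| #|U| ->
  TI_subgroup U G \/ U <| G.
Proof.
move=> p_pr frobG defC sylX oX dH minK sUG p_U.
have [defG ntK _ _ _] := Frobenius_context frobG.
have [nsKG sCG mulKC nKC tiKC] := sdprod_context defG.
have [nsXC sHC mulXH nXH tiXH] := sdprod_context defC.
have [sXC nXC] := andP nsXC; have sXG := subset_trans sXC sCG.
have [sKG nKG] := andP nsKG.
have nKX := subset_trans sXC nKC.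
have ntX: X :!=: 1 by rewrite -cardG_gt1 oX prime_gt1.
have nsKXG: K <*> X <| G.
  rewrite /normal join_subG sKG sXG -{1}mulKC mul_subG //.
    exact: subset_trans (joing_subl _ _) (normG _).
  exact: normsY.
have mulKXH: K <*> X * H = G by rewrite norm_joinEr // -mulgA mulXH.
have [g Gg sXU]: exists2 g, g \in G & X \subset U :^ g.
  have [P sylP] := Sylow_exists p U; have [sPU pP _] := and3P sylP.
  have [g Gg sPX] := Sylow_subJ sylX (subset_trans sPU sUG) pP.
  exists g^-1; rewrite ?groupV // -sub_conjg.
  suffices <-: P :=: X :^ g by [].
  apply/eqP; rewrite eqEcard sPX cardJg oX (card_Hall sylP).
  rewrite dvdn_leq ?part_gt0 //.
  by rewrite -{1}(expn1 p) p_part dvdn_exp2l // logn_gt0 mem_primes p_pr cardG_gt0.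
pose V := (U :^ g)%G.
have sVG: V \subset G by rewrite conj_subG.
have [sKV | notsKV] := boolP (K \subset V).
  right; apply: dedekind_quotient_normal (nsKXG) mulKXH dH _ sUG.
  rewrite -(conjSg _ _ g) (normsP (normal_norm nsKXG)) // join_subG.
  by apply/andP.
left; apply: (TI_subgroupJ Gg); apply: (Frobenius_compl_TI_subgroup (V := V) frobG).
apply: (dedekind_quotient_normal nsXC mulXH dH sXU).
have tiKV: K :&: V = 1.
  apply: contraNeq notsKV => ntKV; have [_ minK'] := mingroupP minK.
  rewrite -(minK' (K :&: V)%G) ?subsetIl ?subsetIr //= ntKV /=.
  by rewrite normsI // (subset_trans sXU) ?normG.
have nXV: V \subset 'N(X).
  have <-: (K <*> X) :&: V = X.
    by rewrite norm_joinEr // setIC -group_modr // setIC tiKV mul1g.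
  by rewrite normsI ?normG // (subset_trans sVG) // normal_norm.
(* Coprimality turns the normaliser into a centraliser, which is trivial by semiregularity. *)
have tiNK: 'N_K(X) = 1.
  rewrite coprime_norm_cent ?(coprimegS sXC) ?(Frobenius_coprime frobG) //.
  exact: cent_semiregular (Frobenius_reg_ker frobG) sXC ntX.
have <-: 'N_G(X) = C.
  by rewrite -mulKC setIC -group_modr // setIC tiNK mul1g.
by rewrite subsetI sVG.
Qed.

End Converse.

(** * Both directions of the equivalence *)

Theorem theorem1p4 (gT : finGroupType) (G : {group gT}) (p : nat)
    (p_prime : prime p) (p_dvd : p %| #|G|) :
  (forall H : {group gT}, H \subset G -> ~~ abelian H ->
     [\/ TI_subgroup H G, H <|<| G | ~~ (p %| #|H|)]) <->
  [\/
   (* (1) *)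
   (forall H : {group gT}, H \subset G -> ~~ abelian H -> p %| #|H| -> H <|<| G),
   (* (2) *)
   (2 < p /\
    exists (q r : nat) (K C P H : {group gT}),
      [/\ [/\ prime q, q != p, 1 < r, q.-abelem K & #|K| = (q ^ r)%N],
          [Frobenius G = K ><| C],
          P \x H = C,
          [/\ p.-Sylow(G) P, cyclic P & Q8_times_odd_cyclic H] &
          forall Y : {group gT}, Y \subset P -> Y :!=: 1 -> acts_irreducibly Y K 'J])
 | (* (3) *)
   (2 < p /\
    exists (q r : nat) (K C X H : {group gT}),
      [/\ [/\ prime q, q != p, 1 < r, q.-abelem K & #|K| = (q ^ r)%N],
          [Frobenius G = K ><| C],
          X ><| H = C,
          [/\ p.-Sylow(G) X, #|X| = p, cyclic H \/ Q8_times_odd_cyclic H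
             & [~: X, H] != 1] &
          acts_irreducibly X K 'J])].
Proof.
split=> [TIp | [sub1 | case2 | case3] U sUG ncUU].
- have TIp' (U : {group gT}) : U \subset G -> ~~ abelian U -> p %| #|U| ->
      TI_subgroup U G \/ U <|<| G.
    by move=> sUG ncUU p_U; case: (TIp U sUG ncUU); rewrite ?p_U //; [left | right].
  have [/existsP[U exU] | noex] :=
    boolP [exists U : {group gT}, exceptional G p U]; last first.
    constructor 1 => U sUG ncUU p_U; apply: contraNT noex => notsnU.
    by apply/existsP; exists U; rewrite /exceptional sUG ncUU p_U.
  have [L maxL _] := maxgroup_exists exU.
  have [K frobG] := max_exceptional_Frobenius TIp' maxL.
  have [q q_pr abelK] := max_exceptional_kernel_abelem TIp' maxL frobG.
  have [/and4P[sLG ncLL p_L _] _] := maxgroupP maxL.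
  have [p_gt2 [X [H [defL sylX oX Hstr ntXH]]]] :=
    complement_structure p_prime TIp' frobG abelK ncLL p_L.
  have [defG ntK _ _ _] := Frobenius_context frobG.
  have [nsKG _ mulKL nKL tiKL] := sdprod_context defG.
  have regL := Frobenius_reg_ker frobG.
  have coKL := Frobenius_coprime frobG.
  have sXL := pHall_sub sylX.
  have qK := abelem_pgroup abelK.
  have [_ q_K _] := pgroup_pdiv qK ntK.
  have neq_qp: q != p.
    apply: contraTneq q_K => ->; rewrite -prime_coprime // coprime_sym.
    exact: coprime_dvdr p_L coKL.
  constructor 3; split=> //; exists q, (logn q #|K|), K, L, X, H.
  split=> //; first 1 last.
  - split=> //; rewrite pHallE (subset_trans sXL) //= (card_Hall sylX).
    rewrite -(sdprod_card defG) partnM ?cardG_gt0 // [(#|K|`_p)%N]part_p'nat ?mul1n //.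
    apply: pi_pnat qK _; rewrite !inE //.
  - rewrite acts_irreduciblyJ (complement_minnormal p_prime TIp' frobG abelK) ?oX //.
  split=> //; last exact: card_pgroup.
  (* If [K] had order [q], even the trivial group would act irreducibly on it, and the Schur
     argument with [Y = 1] would make [L] abelian. *)
  rewrite ltnNge; apply: contra ncLL => le1.
  have oK: #|K| = q.
    have [_ _ [n oK]] := pgroup_pdiv qK ntK.
    by move: le1; rewrite oK pfactorK // ltnS leqn0 => /eqP ->.
  have minK: minnormal K [1 gT].
    apply/mingroupP; rewrite ntK sub1G; split=> // K1 /andP[ntK1 _] sK1K.
    apply/eqP; rewrite eqEcard sK1K oK dvdn_leq //.
    by have [] := pgroup_pdiv (pgroupS sK1K qK) ntK1.
  have := irr_abelian_cent_abelian abelK nKL regL (sub1G L) (abelian1 gT) minK.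
  by rewrite cent1T setIT.
- have [p_U | p'U] := boolP (p %| #|U|); last by constructor 3.
  by constructor 2; apply: sub1.
- case: case2 => _ [q [r [K [C [P [H [[_ _ _ abelK _] frobG defC
    [sylP cycP H8] irrP]]]]]]].
  have [defG ntK _ _ _] := Frobenius_context frobG.
  have [_ _ _ nKC _] := sdprod_context defG.
  have ntP: P :!=: 1.
    by rewrite -cardG_gt1 (card_Hall sylP) p_part_gt1 mem_primes p_prime cardG_gt0.
  have [_ mulPH cPH _] := dprodP defC.
  have minK: minnormal K P by rewrite -acts_irreduciblyJ irrP.
  have sPC: P \subset C by rewrite -mulPH mulG_subl.
  (* Case (2) is contradictory: the centraliser of [P] in [C] is abelian but contains the nonabelian
     [H]. *)
  have cCP := irr_abelian_cent_abelian abelK nKC (Frobenius_reg_ker frobG) sPC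
                (cyclic_abelian cycP) minK.
  case/negP: (Q8_times_odd_cyclic_nonabelian H8); apply: abelianS cCP.
  by rewrite subsetI -mulPH mulG_subr.
case: case3 => _ [q [r [K [C [X [H [_ frobG defC [sylX oX Hstr _] irrX]]]]]]].
have [p_U | p'U] := boolP (p %| #|U|); last by constructor 3.
have dH: dedekind H.
  by case: Hstr => [/cyclic_abelian/abelian_dedekind | /Q8_times_odd_cyclic_dedekind].
rewrite acts_irreduciblyJ in irrX.
have [] := Frobenius_prime_irr_TI_or_normal p_prime frobG defC sylX oX dH irrX sUG p_U.
  by constructor 1.
by constructor 2; apply: normal_subnormal.
Qed.
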